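(* Let $\mathbb K$ be a field of characteristic zero and let $$\Psi=\sum_{s=0}^{+\infty}\sum_{j=2}^{+\infty}x_{j,s}\Psi_{j,s},\qquad x_{j,s}\in\mathbb K,$$ be a formal series in the cocycles $\Psi_{j,s}$ of $\mathfrak m_0$ (defined in the context), i.e. an element of the completed space $\oplus_{s\ge 0}H^2_s(\mathfrak m_0,\mathfrak m_0)$. Then the cocycle $\Psi$ satisfies the deformation equation $[\Psi,\Psi]=0$ if and only if the coefficients $x_{j,s}$ satisfy the system of quadratic equations $F_{j,q,r}=0$ for all integers $j,q,r$ with $2\le j<q$, $r\ge 0$, where $$\begin{aligned} F_{j,q,r}={}&\sum_{t=0}^r\ \sum_{l=j}^{\left[\frac{j+q-1}{2}\right]}\ \sum_{m=q+1}^{q+\left[\frac{j+t}{2}\right]}(-1)^{l-j+m-q}\binom{q-l-1}{l-j}\binom{j+q-m+t-1}{m-q-1}x_{l,t}\,x_{m,r-t}\\ &+\sum_{t=0}^r\ \sum_{l=j}^{\left[\frac{j+q}{2}\right]}\ \sum_{m=q}^{q+\left[\frac{j+t}{2}\right]}(-1)^{l-j+m-q}\binom{q-l}{l-j}\binom{j+q-m+t}{m-q}x_{l,t}\,x_{m,r-t}\\ &+\sum_{t=0}^r\ \sum_{m=j}^{q+\left[\frac{j+t}{2}\right]}(-1)^{m-j+1}\binom{2q-m+t}{m-j}x_{q,t}\,x_{m,r-t}. \end{aligned}$$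
   Context: $\mathfrak m_0$ is the Lie algebra over $\mathbb K$ with basis $e_1,e_2,e_3,\dots$ and nonzero brackets $[e_1,e_i]=e_{i+1}$, $i\ge 2$ (all other brackets of basis vectors, up to skew-symmetry, vanish). It is graded by giving $e_i$ degree $i$. A $q$-cochain with values in $\mathfrak m_0$ (adjoint representation) is homogeneous of degree $s$ if it sends $(e_{i_1},\dots,e_{i_q})$ to a multiple of $e_{i_1+\dots+i_q+s}$; $H^2_s(\mathfrak m_0,\mathfrak m_0)$ is the degree $s$ part of the second cohomology with adjoint coefficients. For $j\ge 2$, $s\ge 0$, $\Psi_{j,s}$ is the skew-symmetric bilinear map (a 2-cocycle of degree $s$) given by $$\Psi_{j,s}(e_k,e_m)=(-1)^{j-k}\binom{m-j-1}{j-k}\,e_{k+m+s}\quad\text{for } 2\le k\le j<m,\ k+m\ge 2j+1,$$ and $\Psi_{j,s}(e_k,e_m)=0$ for all other pairs $k<m$ (in particular $\Psi_{j,s}(e_1,\cdot)=0$). For skew-symmetric bilinear maps $\Psi,\tilde\Psi$ the Nijenhuis–Richardson bracket is $$[\Psi,\tilde\Psi](x,y,z)=\Psi(\tilde\Psi(x,y),z)+\Psi(\tilde\Psi(y,z),x)+\Psi(\tilde\Psi(z,x),y)+\tilde\Psi(\Psi(x,y),z)+\tilde\Psi(\Psi(y,z),x)+\tilde\Psi(\Psi(z,x),y).$$ For a formal series $\Psi=\sum_{s\ge0}\Psi_s$ with homogeneous components $\Psi_s=\sum_{j\ge2}x_{j,s}\Psi_{j,s}$ (each $\Psi_s$ is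 a well-defined bilinear map, since only finitely many $\Psi_{j,s}$ are nonzero on a given pair of basis vectors), $[\Psi,\Psi]$ is defined degreewise: its degree $r$ component is $\sum_{s+t=r}[\Psi_s,\Psi_t]$, and $[\Psi,\Psi]=0$ means that all these components vanish. $[a]$ for a rational number $a$ (in summation limits) denotes the integer part; empty sums are zero. *)

(* Defs.v *)
From HB Require Import structures.
From mathcomp Require Import all_boot all_order all_algebra finmap.
From mathcomp Require Import monalg zify.

Set Implicit Arguments.
Unset Strict Implicit.
Unset Printing Implicit Defensive.

Import GRing.Theory.
Local Open Scope ring_scope.

(* The underlying vector space of m_0, as the free K-module on [nat]; the index
   i stands for e_(i+1), so that the basis is e_1, e_2, ... *)
Notation m0 K := {malg K[nat]}.

(* [e n] is the basis vector e_n for n >= 1; the junk value [e 0] is 0. *)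
Definition e {K : fieldType} (n : nat) : m0 K :=
  if n is i.+1 then << i >> else 0.
Arguments e {K} n : simpl never.

Definition skew {K : fieldType} (f : nat -> nat -> m0 K) (k m : nat) : m0 K :=
  if (k < m)%N then f k m else if (m < k)%N then - f m k else 0.

(* The skew-symmetric bilinear map whose value on (e_k, e_m) is [f k m] for
   1 <= k < m; the values of [f] at other pairs are irrelevant. *)
Definition skew_ext {K : fieldType} (f : nat -> nat -> m0 K) (u v : m0 K)
    : m0 K :=
  \sum_(k <- msupp u) \sum_(m <- msupp v)
     (u@_k * v@_m) *: skew f k.+1 m.+1.

Definition lie {K : fieldType} : m0 K -> m0 K -> m0 K :=
  skew_ext (fun k m => if (k == 1)%N then e m.+1 else 0).

Definition Psi {K : fieldType} (j s : nat) : m0 K -> m0 K -> m0 K :=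
  skew_ext (fun k m =>
    if [&& (2 <= k)%N, (k <= j)%N, (j < m)%N & (2 * j + 1 <= k + m)%N]
    then ((-1) ^+ (j - k) * 'C(m - j - 1, j - k)%:R) *: e (k + m + s)
    else 0).

(* The degree s component Psi_s = \sum_(j >= 2) x_{j,s} Psi_{j,s}.  Only the
   indices j < m contribute to the value on (e_k, e_m), k < m; see
   [Psi_compE]. *)
Definition Psi_comp {K : fieldType} (x : nat -> nat -> K) (s : nat)
    : m0 K -> m0 K -> m0 K :=
  skew_ext (fun k m => \sum_(2 <= j < m) x j s *: Psi j s (e k) (e m)).

(* The Nijenhuis-Richardson bracket. *)
Definition NR {K : fieldType} (P Q : m0 K -> m0 K -> m0 K) (u v w : m0 K)
    : m0 K :=
  P (Q u v) w + P (Q v w) u + P (Q w u) v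
  + Q (P u v) w + Q (P v w) u + Q (P w u) v.

(* A formal series \sum_(s >= 0) P_s, with P_s homogeneous of degree s, is
   represented by the sequence of its components. *)
Definition NR_series {K : fieldType} (P Q : nat -> m0 K -> m0 K -> m0 K)
    (r : nat) (u v w : m0 K) : m0 K :=
  \sum_(0 <= s < r.+1) NR (P s) (Q (r - s)%N) u v w.

Definition deformation_equation {K : fieldType}
    (P : nat -> m0 K -> m0 K -> m0 K) : Prop :=
  forall (r : nat) (u v w : m0 K), NR_series P P r u v w = 0.

(* For 2 <= j < q every subtraction below is a genuine one on the summation
   ranges, so that no binomial coefficient has a truncated argument. *)
Definition F {K : fieldType} (x : nat -> nat -> K) (j q r : nat) : K :=
  \sum_(0 <= t < r.+1)
   \sum_(j <= l < ((j + q - 1) %/ 2).+1)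
    \sum_(q + 1 <= m < (q + (j + t) %/ 2).+1)
      (-1) ^+ (l - j + (m - q))
      * 'C(q - l - 1, l - j)%:R * 'C(j + q + t - m - 1, m - q - 1)%:R
      * x l t * x m (r - t)%N
  + \sum_(0 <= t < r.+1)
   \sum_(j <= l < ((j + q) %/ 2).+1)
    \sum_(q <= m < (q + (j + t) %/ 2).+1)
      (-1) ^+ (l - j + (m - q))
      * 'C(q - l, l - j)%:R * 'C(j + q + t - m, m - q)%:R
      * x l t * x m (r - t)%N
  + \sum_(0 <= t < r.+1)
   \sum_(j <= m < (q + (j + t) %/ 2).+1)
      (-1) ^+ (m - j + 1) * 'C(2 * q + t - m, m - j)%:R
      * x q t * x m (r - t)%N.

Lemma addr3ACA (V : zmodType) (a1 b1 a2 b2 a3 b3 : V) :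
  (a1 + b1) + (a2 + b2) + (a3 + b3) = (a1 + a2 + a3) + (b1 + b2 + b3).
Proof. by do 2![rewrite [RHS]addrACA; congr (_ + (_ + _))]. Qed.

Lemma addr6ACA (V : zmodType) (a1 b1 a2 b2 a3 b3 a4 b4 a5 b5 a6 b6 : V) :
  (a1 + b1) + (a2 + b2) + (a3 + b3) + (a4 + b4) + (a5 + b5) + (a6 + b6)
  = (a1 + a2 + a3 + a4 + a5 + a6) + (b1 + b2 + b3 + b4 + b5 + b6).
Proof. by do 5![rewrite [RHS]addrACA; congr (_ + (_ + _))]. Qed.

Section SkewExt.
Variable K : fieldType.
Implicit Types (f : nat -> nat -> m0 K) (u v w : m0 K).

Lemma e_spanE u : u = \sum_(k <- msupp u) u@_k *: e k.+1.
Proof.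
rewrite {1}[u]monalgE; apply: eq_bigr => k _.
by apply/malgP => i; rewrite mcoeffZ !mcoeffU mulr_natr.
Qed.

Lemma skewC f k m : skew f k m = - skew f m k.
Proof. by rewrite /skew; case: (ltngtP k m); rewrite ?opprK ?oppr0. Qed.

Lemma skew_extEw f (A B : {fset nat}) u v :
  (msupp u `<=` A)%fset -> (msupp v `<=` B)%fset ->
  skew_ext f u v = \sum_(k <- A) \sum_(m <- B)
     (u@_k * v@_m) *: skew f k.+1 m.+1.
Proof.
move=> uA vB; rewrite /skew_ext.
rewrite [LHS](big_fset_incl _ uA) => [|k _ ku]; last first.
  by apply: big1 => m _; rewrite (mcoeff_outdom ku) mul0r scale0r.
apply: eq_bigr => k _; apply: (big_fset_incl _ vB) => m _ mv.
by rewrite (mcoeff_outdom mv) mulr0 scale0r.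
Qed.

Lemma skew_extC f u v : skew_ext f u v = - skew_ext f v u.
Proof.
rewrite /skew_ext exchange_big -sumrN; apply: eq_bigr => k _.
rewrite -sumrN; apply: eq_bigr => m _.
by rewrite mulrC skewC scalerN.
Qed.

Lemma skew_ext_linl f a u u' v :
  skew_ext f (a *: u + u') v = a *: skew_ext f u v + skew_ext f u' v.
Proof.
pose A := (msupp (a *: u + u') `|` (msupp u `|` msupp u'))%fset.
have sA1 : (msupp (a *: u + u') `<=` A)%fset by rewrite fsubsetUl.
have sA2 : (msupp u `<=` A)%fset.
  by rewrite fsubsetU // fsubsetUl orbT.
have sA3 : (msupp u' `<=` A)%fset.
  by rewrite fsubsetU // fsubsetUr orbT.
have vv := fsubset_refl (msupp v).
rewrite (skew_extEw _ sA1 vv) (skew_extEw _ sA2 vv) (skew_extEw _ sA3 vv).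
rewrite scaler_sumr -big_split; apply: eq_bigr => k _ /=.
rewrite scaler_sumr -big_split; apply: eq_bigr => m _ /=.
by rewrite mcoeffD mcoeffZ scalerA mulrDl scalerDl mulrA.
Qed.

Lemma skew_ext_linr f a u v v' :
  skew_ext f u (a *: v + v') = a *: skew_ext f u v + skew_ext f u v'.
Proof.
rewrite skew_extC skew_ext_linl opprD -scalerN.
by rewrite -!(skew_extC f u).
Qed.

Lemma skew_ext_e f k m : (0 < k)%N -> (0 < m)%N ->
  skew_ext f (e k) (e m) = skew f k m.
Proof.
case: k m => [//|k] [//|m] _ _.
rewrite /e (skew_extEw _ (msuppU_le) (msuppU_le)) !big_seq_fset1.
by rewrite !mcoeffUU mulr1 scale1r.
Qed.

Lemma skew_ext0l f v : skew_ext f 0 v = 0.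
Proof.
by have := skew_ext_linl f (-1) 0 0 v; rewrite addr0 scaler0 scaleN1r addNr.
Qed.

Lemma skew_ext_suml f I (r : seq I) (a : I -> K) (g : I -> m0 K) v :
  skew_ext f (\sum_(i <- r) a i *: g i) v
  = \sum_(i <- r) a i *: skew_ext f (g i) v.
Proof.
elim: r => [|i r IH]; first by rewrite !big_nil skew_ext0l.
by rewrite !big_cons skew_ext_linl IH.
Qed.

Lemma skew_ext_sumr f I (r : seq I) (a : I -> K) (g : I -> m0 K) u :
  skew_ext f u (\sum_(i <- r) a i *: g i)
  = \sum_(i <- r) a i *: skew_ext f u (g i).
Proof.
rewrite skew_extC skew_ext_suml -sumrN; apply: eq_bigr => i _.
by rewrite -scalerN -skew_extC.
Qed.

Lemma Psi_eE j s k m : (0 < k < m)%N ->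
  Psi j s (e k) (e m) =
    if [&& (2 <= k)%N, (k <= j)%N, (j < m)%N & (2 * j + 1 <= k + m)%N]
    then ((-1) ^+ (j - k) * 'C(m - j - 1, j - k)%:R) *: e (k + m + s)
    else 0 :> m0 K.
Proof.
case/andP=> k0 km; rewrite /Psi skew_ext_e ?(ltn_trans k0 km) //.
by rewrite /skew km.
Qed.

Lemma lie_eE k m : (0 < k < m)%N ->
  lie (e k) (e m) = if (k == 1)%N then e m.+1 else 0 :> m0 K.
Proof.
case/andP=> k0 km; rewrite /lie skew_ext_e ?(ltn_trans k0 km) //.
by rewrite /skew km.
Qed.

Lemma Psi_eC j s k m : Psi j s (e k) (e m) = - Psi j s (e m) (e k) :> m0 K.
Proof. exact: skew_extC. Qed.

Lemma Psi_ee j s k : Psi j s (e k) (e k) = 0 :> m0 K.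
Proof.
case: k => [|k]; first by rewrite /Psi skew_ext0l.
by rewrite /Psi skew_ext_e // /skew ltnn.
Qed.

Lemma Psi_e_out j s k m : (maxn k m <= j)%N -> Psi j s (e k) (e m) = 0 :> m0 K.
Proof.
rewrite geq_max => /andP[kj mj]; case: (posnP k) => [->|k0].
  by rewrite /Psi skew_ext0l.
case: (posnP m) => [->|mpos]; first by rewrite Psi_eC /Psi skew_ext0l oppr0.
case: (ltngtP k m) => [km|mk|->]; last exact: Psi_ee.
  by rewrite Psi_eE ?k0 // [(j < m)%N]ltnNge mj !andbF.
by rewrite Psi_eC Psi_eE ?mpos // [(j < k)%N]ltnNge kj !andbF oppr0.
Qed.

Lemma Psi_comp_eE x s k m N : (0 < k)%N -> (0 < m)%N -> (maxn k m <= N)%N ->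
  Psi_comp x s (e k) (e m) = \sum_(2 <= j < N) x j s *: Psi j s (e k) (e m)
    :> m0 K.
Proof.
have cutE a b : (0 < a < b)%N -> (b <= N)%N ->
    \sum_(2 <= j < N) x j s *: Psi j s (e a) (e b)
    = \sum_(2 <= j < b) x j s *: Psi j s (e a) (e b) :> m0 K.
  case/andP=> a0 ab bN.
  have z n j : (b <= j < n)%N -> x j s *: Psi j s (e a) (e b) = 0 :> m0 K.
    by case/andP=> bj _; rewrite Psi_e_out ?scaler0 // geq_max bj
      (leq_trans (ltnW ab)).
  have [b2|b2] := leqP 2 b.
    rewrite (big_cat_nat b2 bN) /= -[RHS]addr0; congr (_ + _).
    by rewrite big_nat_cond big1 // => j; rewrite andbT => /z.
  rewrite [RHS]big_geq 1?ltnW // big_nat_cond big1 // => j.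
  rewrite andbT => /andP[j2 jN].
  by apply: (z N); rewrite jN (leq_trans _ j2) // ltnW.
move=> k0 mpos; rewrite geq_max => /andP[kN mN].
rewrite /Psi_comp skew_ext_e // /skew.
case: (ltngtP k m) => [km|mk|->].
- by rewrite cutE ?k0.
- rewrite -cutE ?mpos // -sumrN; apply: eq_bigr => j _.
  by rewrite [Psi _ _ (e k) _]Psi_eC scalerN.
- by rewrite big1 // => j _; rewrite Psi_ee scaler0.
Qed.

Lemma Psi_compE x s u v : exists N0, forall N, (N0 <= N)%N ->
  Psi_comp x s u v = \sum_(2 <= j < N) x j s *: Psi j s u v.
Proof.
exists (maxn (\max_(k <- msupp u) k.+1) (\max_(m <- msupp v) m.+1)) => N.
rewrite geq_max => /andP[uN vN].
have expand f : skew_ext f u v =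
    \sum_(k <- msupp u) u@_k *: \sum_(m <- msupp v) v@_m *:
       skew_ext f (e k.+1) (e m.+1).
  rewrite {1}[u]e_spanE {1}[v]e_spanE skew_ext_suml; apply: eq_bigr => k _.
  by rewrite skew_ext_sumr.
rewrite /Psi_comp expand.
under [RHS]eq_bigr => j _ do rewrite {1}/Psi expand scaler_sumr.
rewrite exchange_big /=; apply: eq_big_seq => k ku.
under [RHS]eq_bigr => j _ do rewrite scalerA mulrC -scalerA.
rewrite -scaler_sumr; congr (_ *: _).
under [RHS]eq_bigr => j _ do rewrite scaler_sumr.
rewrite exchange_big /=; apply: eq_big_seq => m mv.
under [RHS]eq_bigr => j _ do rewrite scalerA mulrC -scalerA.
rewrite -scaler_sumr; congr (_ *: _).
apply: Psi_comp_eE => //; rewrite geq_max (leq_trans _ uN) ?(leq_trans _ vN) //.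
  exact: (@leq_bigmax_seq _ _ _ (fun i : nat => i.+1)).
exact: (@leq_bigmax_seq _ _ _ (fun i : nat => i.+1)).
Qed.

(* [NR lie Q] is the Chevalley-Eilenberg differential of Q with adjoint
   coefficients. *)
Definition cocycle2 (Q : m0 K -> m0 K -> m0 K) : Prop :=
  forall u v w, NR lie Q u v w = 0.

Lemma NR_cyc (P Q : m0 K -> m0 K -> m0 K) u v w : NR P Q u v w = NR P Q v w u.
Proof. by rewrite /NR [RHS](ACl (3*1*2*6*4*5)). Qed.

Definition bilin (P : m0 K -> m0 K -> m0 K) : Prop :=
  (forall a u u' v, P (a *: u + u') v = a *: P u v + P u' v) /\
  (forall a u v v', P u (a *: v + v') = a *: P u v + P u v').

Lemma skew_ext_bilin f : bilin (skew_ext f).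
Proof. by split=> *; [apply: skew_ext_linl | apply: skew_ext_linr]. Qed.

Lemma NR_linl P Q a u u' v w : bilin P -> bilin Q ->
  NR P Q (a *: u + u') v w = a *: NR P Q u v w + NR P Q u' v w.
Proof.
case=> Pl Pr [Ql Qr]; rewrite /NR.
rewrite !(Pl, Pr, Ql, Qr) !scalerDr.
exact: addr6ACA.
Qed.

Lemma NR_bilin_e P Q : bilin P -> bilin Q ->
  (forall a b c, (0 < a)%N -> (0 < b)%N -> (0 < c)%N ->
     NR P Q (e a) (e b) (e c) = 0) ->
  forall u v w, NR P Q u v w = 0.
Proof.
move=> bP bQ T0.
have ext v w : (forall i : nat, NR P Q (e i.+1) v w = 0) ->
    forall u, NR P Q u v w = 0.
  have Tz : NR P Q 0 v w = 0.
    have := NR_linl (-1) 0 0 v w bP bQ.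
    by rewrite addr0 scaler0 scaleN1r addNr.
  move=> Te u; rewrite (e_spanE u); elim: (enum_fset _) => [|i r IH].
    by rewrite big_nil.
  by rewrite big_cons NR_linl // IH Te scaler0 addr0.
move=> u v w; apply: (ext _ _ _) => i; rewrite NR_cyc; apply: (ext _ _ _) => j.
rewrite NR_cyc; apply: (ext _ _ _) => k.
exact: T0.
Qed.

Definition psi j (k m : nat) : K :=
  if [&& (2 <= k)%N, (k <= j)%N, (j < m)%N & (2 * j + 1 <= k + m)%N]
  then (-1) ^+ (j - k) * 'C(m - j - 1, j - k)%:R else 0.

Definition spsi j (k m : nat) : K :=
  if (k < m)%N then psi j k m else if (m < k)%N then - psi j m k else 0.

Lemma Psi_spsiE j s k m : (0 < k)%N -> (0 < m)%N ->
  Psi j s (e k) (e m) = spsi j k m *: e (k + m + s) :> m0 K.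
Proof.
move=> k0 mpos; rewrite /Psi skew_ext_e // /skew /spsi /psi.
case: ltngtP => _; last by rewrite scale0r.
  by case: ifP => // _; rewrite scale0r.
rewrite scaleNr [(m + k)%N]addnC; congr (- _).
by case: ifP => // _; rewrite scale0r.
Qed.

Lemma psiE j k m : (2 <= k)%N -> psi j k m =
  if (k <= j < m)%N then (-1) ^+ (j - k) * 'C(m - j - 1, j - k)%:R else 0.
Proof.
rewrite /psi => -> /=; case: (leqP k j) => //= kj; case: (ltnP j m) => //= jm.
case: leqP => // h; rewrite bin_small ?mulr0 //; lia.
Qed.

Lemma spsi_pascal j k m : (2 <= k)%N -> (2 <= m)%N ->
  spsi j k.+1 m + spsi j k m.+1 = spsi j k m.
Proof.
wlog km : k m / (k <= m)%N => [hw|] k2 m2.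
  have spsiC a b : spsi j a b = - spsi j b a.
    by rewrite /spsi; case: (ltngtP a b); rewrite ?opprK ?oppr0.
  have [km|/ltnW mk] := leqP k m; first exact: hw.
  rewrite spsiC [spsi j k m]spsiC [spsi j k m.+1]spsiC -opprD addrC.
  by congr (- _); apply: hw.
move: km; rewrite leq_eqVlt => /orP[/eqP <-|km].
  by rewrite /spsi ltnS leqnn ltnn ltnNge leqnSn /= addNr.
have e1 : spsi j k m.+1 = psi j k m.+1 by rewrite /spsi ltnS ltnW.
have e2 : spsi j k m = psi j k m by rewrite /spsi km.
have e3 : spsi j k.+1 m = psi j k.+1 m.
  move: km; rewrite leq_eqVlt => /orP[/eqP <-|km]; last by rewrite /spsi km.
  rewrite /spsi ltnn /psi; case: ifP => // /and4P[_ a b _].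
  by move: (leq_trans b a); rewrite ltnn.
rewrite {}e1 {}e2 {}e3 (psiE j m.+1 k2) (psiE j m k2).
rewrite (psiE j m (ltnW k2 : 1 < k.+1)%N).
case: (leqP k j) => [kj|jk]; last by rewrite !ifF ?addr0 //; lia.
case: (ltnP j m) => [jm|mj].
  rewrite [(j < m.+1)%N]ltnW //=.
  have -> : (m.+1 - j - 1 = (m - j - 1).+1)%N by lia.
  case: (ltnP k j) => [lt_kj|jk]; last first.
    have -> : (j - k = 0)%N by lia.
    by rewrite !bin0 add0r.
  have -> : (j - k = (j - k.+1).+1)%N by lia.
  by rewrite binS natrD exprS !mulN1r !mulNr mulrDr opprD addrCA addrN addr0.
rewrite !andbF add0r.
by case: ifP => // h; rewrite bin_small ?mulr0 //; lia.
Qed.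

Lemma lie_bilin : bilin (@lie K).
Proof. exact: skew_ext_bilin. Qed.

Lemma Psi_bilin j s : bilin (@Psi K j s).
Proof. exact: skew_ext_bilin. Qed.

Lemma lie_eC k m : lie (e k) (e m) = - lie (e m) (e k) :> m0 K.
Proof. exact: skew_extC. Qed.

Lemma lie1e k : (2 <= k)%N -> lie (e 1) (e k) = e k.+1 :> m0 K.
Proof. by move=> k2; rewrite lie_eE. Qed.

Lemma lie_ge2 k m : (2 <= k)%N -> (2 <= m)%N -> lie (e k) (e m) = 0 :> m0 K.
Proof.
move=> k2 m2; rewrite /lie (skew_ext_e _ (ltnW k2) (ltnW m2)) /skew.
by rewrite !gtn_eqF // oppr0 !if_same.
Qed.

Lemma lie_ee k : lie (e k) (e k) = 0 :> m0 K.
Proof.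
case: k => [|k]; first by rewrite /lie skew_ext0l.
by rewrite /lie skew_ext_e // /skew ltnn.
Qed.

Lemma skew_extZl f a u v : skew_ext f (a *: u) v = a *: skew_ext f u v.
Proof. by have := skew_ext_linl f a u 0 v; rewrite skew_ext0l !addr0. Qed.

Lemma skew_extNl f u v : skew_ext f (- u) v = - skew_ext f u v.
Proof. by rewrite -[- u]scaleN1r skew_extZl scaleN1r. Qed.

Lemma Psi_e1r j s u : Psi j s u (e 1) = 0 :> m0 K.
Proof.
rewrite (e_spanE u) /Psi skew_ext_suml big1 // => k _.
rewrite -/(Psi j s _ _) Psi_spsiE // /spsi [(k.+1 < 1)%N]ltnS ltn0 /psi.
by rewrite /= oppr0 if_same scale0r scaler0.
Qed.

Lemma lie_jacobi u v w :
  lie (lie u v) w + lie (lie v w) u + lie (lie w u) v = 0 :> m0 K.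
Proof.
have L0 x : lie 0 x = 0 :> m0 K by apply: skew_ext0l.
have LN x y : lie (- x) y = - lie x y :> m0 K by apply: skew_extNl.
pose J x y z : m0 K := lie (lie x y) z + lie (lie y z) x + lie (lie z x) y.
have cyc x y z : J x y z = J y z x by rewrite /J [RHS](ACl (3*1*2)).
have Jl a x x' y z : J (a *: x + x') y z = a *: J x y z + J x' y z.
  have [Ll Lr] := lie_bilin; rewrite /J !(Ll, Lr) !scalerDr.
  exact: addr3ACA.
have ext y z : (forall i, J (e i.+1) y z = 0) -> forall x, J x y z = 0.
  have Jz : J 0 y z = 0.
    by have := Jl (-1) 0 0 y z; rewrite addr0 scaler0 scaleN1r addNr.
  move=> Je x; rewrite (e_spanE x); elim: (enum_fset _) => [|i r IH].
    by rewrite big_nil.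
  by rewrite big_cons Jl IH Je scaler0 addr0.
have one b c : (0 < b)%N -> (0 < c)%N -> J (e 1) (e b) (e c) = 0.
  move=> b0 c0; rewrite /J; case: (ltngtP 1 b) => [b1|/(leq_trans b0)//|<-].
    case: (ltngtP 1 c) => [c1|/(leq_trans c0)//|<-].
      rewrite (lie1e b1) (lie_ge2 (leqW b1) c1) (lie_ge2 b1 c1) L0.
      by rewrite [lie (e c) _]lie_eC lie1e // LN lie_ge2 ?leqW // oppr0 !addr0.
    by rewrite lie_ee L0 addr0 [lie (e b) _]lie_eC LN addrN.
  by rewrite lie_ee L0 add0r [lie (e c) _]lie_eC LN addrN.
suff JE a b c : (0 < a)%N -> (0 < b)%N -> (0 < c)%N -> J (e a) (e b) (e c) = 0.
  rewrite -/(J u v w); move: u; apply: (ext v w) => i; rewrite cyc.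
  move: v; apply: (ext w _) => k; rewrite cyc.
  by move: w; apply: (ext _ _) => l; apply: JE.
move=> a0 b0 c0.
case: (ltngtP 1 a) => [a1|/(leq_trans a0)//|<-]; last exact: one.
case: (ltngtP 1 b) => [b1|/(leq_trans b0)//|<-]; last by rewrite cyc one.
case: (ltngtP 1 c) => [c1|/(leq_trans c0)//|<-]; last by rewrite -cyc one.
by rewrite /J !lie_ge2 // !L0 !addr0.
Qed.

Lemma Psi_cocycle j s : cocycle2 (@Psi K j s).
Proof.
have P0 v : Psi j s 0 v = 0 :> m0 K by apply: skew_ext0l.
have PN u v : Psi j s (- u) v = - Psi j s u v :> m0 K by apply: skew_extNl.
have L0 v : lie 0 v = 0 :> m0 K by apply: skew_ext0l.
have LZ a u v : lie (a *: u) v = a *: lie u v :> m0 K by apply: skew_extZl.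
have P1 u : Psi j s (e 1) u = 0 :> m0 K.
  have := skew_extC; rewrite /Psi => ->.
  by rewrite -/(Psi j s _ _) Psi_e1r oppr0.
have one b c : (0 < b)%N -> (0 < c)%N ->
    NR lie (Psi j s) (e 1) (e b) (e c) = 0 :> m0 K.
  move=> b0 c0; rewrite /NR P1 !Psi_e1r !L0 add0r !addr0.
  case: (ltngtP 1 b) => [b1|/(leq_trans b0)//|<-]; last first.
    by rewrite P1 L0 lie_ee P0 !Psi_e1r !addr0.
  case: (ltngtP 1 c) => [c1|/(leq_trans c0)//|<-]; last first.
    by rewrite !Psi_e1r L0 lie_ee P0 !addr0.
  rewrite lie1e // [lie (e c) _]lie_eC lie1e // PN !Psi_spsiE // LZ.
  rewrite lie_eC lie1e ?addn_gt0 //; last lia.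
  have -> : (b.+1 + c + s = (b + c + s).+1)%N by lia.
  have -> : (c.+1 + b + s = (b + c + s).+1)%N by lia.
  rewrite -(spsi_pascal j b1 c1).
  have -> : spsi j b c.+1 = - spsi j c.+1 b.
    by rewrite /spsi; case: (ltngtP b c.+1); rewrite ?opprK ?oppr0.
  by rewrite -addrA -scalerBl scalerN addNr.
apply: NR_bilin_e lie_bilin (Psi_bilin j s) _ => a b c a0 b0 c0.
case: (ltngtP 1 a) => [a1|/(leq_trans a0)//|<-]; last exact: one.
case: (ltngtP 1 b) => [b1|/(leq_trans b0)//|<-]; last by rewrite NR_cyc one.
case: (ltngtP 1 c) => [c1|/(leq_trans c0)//|<-]; last by rewrite -NR_cyc one.
rewrite /NR !lie_ge2 // !P0 !Psi_spsiE // !LZ !lie_ge2 ?scaler0 ?addr0 //; lia.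
Qed.

End SkewExt.

(* Main.v *)
Require Import Defs.
From mathcomp Require Import all_boot all_order all_algebra.
From mathcomp Require Import monalg zify ring.

Set Implicit Arguments.
Unset Strict Implicit.
Unset Printing Implicit Defensive.

Import GRing.Theory.
Local Open Scope ring_scope.

(** Write [Psi_s (e_k, e_m) = A_s(k, m) e_(k+m+s)].  The cocycle condition for
    [Psi_s], evaluated on a triple containing [e_1], says that the skew
    function [A_s] satisfies the Pascal rule
      [A_s(k+1, m) + A_s(k, m+1) = A_s(k, m)]  for [k, m >= 2].
    Likewise the degree [r] part of [[Psi, Psi]] on [(e_a, e_b, e_c)] is
    [2 G(a, b, c) e_(a+b+c+r)], where [G(a, b, c)] sums the products
    [A_t(a, b) A_(r-t)(a+b+t, c)] over [t] and over the cyclic permutations of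
    [(a, b, c)].  Two applications of the rule for [A] give a three-variable
    Pascal rule for [G] (this is the closedness of [[Psi, Psi]]):
      [G(a+1, b, c) + G(a, b+1, c) + G(a, b, c+1) = G(a, b, c)].

    [G] is skew-symmetric, and it vanishes when an argument is 1.  Read as a
    formula for [G(a, b, c+1)], the rule expresses [G] on [a < b < c] through
    triples that have closer last entries or a repeated entry, so [G] vanishes
    everywhere as soon as it vanishes on the triples [(j, q, q+1)] with
    [2 <= j < q] ([square_coef_eq0]).  Finally [F_(j,q,r)] is the value of [G]
    at [(j, q, q+1)] ([F_square_coef]): its three sums are the three cyclic
    terms, expanded with the binomial formula for [A] ([Psi_coefE]), and the
    last one is a double sum because [A_t(q, q+1) = x_(q,t)].  The factor 2 is
    invertible in characteristic zero, which gives the equivalence. *)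

(** * Reduction to basis vectors *)

(** The components of a bracket series are sums of brackets, not single ones,
    so the extension from basis vectors is redone for the sum; cyclic
    invariance makes linearity in the first argument sufficient. *)
Lemma NR_series_eq0_basis (K : fieldType) (P : nat -> m0 K -> m0 K -> m0 K) r :
  (forall s, bilin (P s)) ->
  (forall a b c, (0 < a)%N -> (0 < b)%N -> (0 < c)%N ->
     NR_series P P r (e a) (e b) (e c) = 0) ->
  forall u v w, NR_series P P r u v w = 0.
Proof.
move=> bP T0; set T := NR_series _ _ r in T0 *.
have cyc u v w : T u v w = T v w u.
  by apply: eq_bigr => s _; apply: NR_cyc.
have Tl a u u' v w : T (a *: u + u') v w = a *: T u v w + T u' v w.
  rewrite /T /NR_series scaler_sumr -big_split; apply: eq_bigr => s _ /=.
  exact: NR_linl.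
have ext v w : (forall i : nat, T (e i.+1) v w = 0) -> forall u, T u v w = 0.
  move=> Te u; rewrite (e_spanE u); elim: (finmap.enum_fset _) => [|i s IH].
    rewrite big_nil; have := Tl (-1) 0 0 v w.
    by rewrite addr0 scaler0 scaleN1r addNr.
  by rewrite big_cons Tl IH Te scaler0 addr0.
move=> u v w; apply: (ext _ _ _) => i; rewrite cyc; apply: (ext _ _ _) => k.
by rewrite cyc; apply: (ext _ _ _) => l; apply: T0.
Qed.

Lemma e_neq0 (K : fieldType) n : (0 < n)%N -> e n != 0 :> m0 K.
Proof. by case: n => // n _; rewrite /e monalgU_eq0 oner_neq0. Qed.

(** * Structure constants of a combination of the cocycles *)

Section Coefficients.
Variables (K : fieldType) (x : nat -> nat -> K).

Definition Psi_coef (s k m : nat) : K :=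
  \sum_(2 <= j < maxn k m) x j s * spsi K j k m.

Lemma Psi_comp_coefE s k m : (0 < k)%N -> (0 < m)%N ->
  Psi_comp x s (e k) (e m) = Psi_coef s k m *: e (k + m + s) :> m0 K.
Proof.
move=> k0 mpos; rewrite (Psi_comp_eE x s k0 mpos (leqnn _)) scaler_suml.
by apply: eq_bigr => j _; rewrite Psi_spsiE // scalerA.
Qed.

Lemma spsiC j k m : spsi K j k m = - spsi K j m k.
Proof. by rewrite /spsi; case: (ltngtP k m); rewrite ?opprK ?oppr0. Qed.

Lemma spsi_out j k m : (maxn k m <= j)%N -> spsi K j k m = 0.
Proof.
rewrite geq_max /spsi /psi => /andP[kj mj].
by rewrite ![(j < _)%N]ltnNge kj mj !andbF oppr0 !if_same.
Qed.

(** Putting an arbitrary large bound on the sum lets values of [Psi_coef] at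
    different pairs be added termwise. *)
Lemma Psi_coef_widen N s k m : (maxn k m <= N)%N ->
  Psi_coef s k m = \sum_(2 <= j < N) x j s * spsi K j k m.
Proof.
move=> kmN; rewrite /Psi_coef (big_nat_widen _ _ _ _ _ kmN) big_mkcond.
apply: eq_big_nat => j _; case: ltnP => // jN.
by rewrite spsi_out ?mulr0.
Qed.

Lemma Psi_coefC s k m : Psi_coef s k m = - Psi_coef s m k.
Proof.
rewrite /Psi_coef maxnC -sumrN; apply: eq_bigr => j _.
by rewrite spsiC mulrN.
Qed.

Lemma Psi_coef_diag s k : Psi_coef s k k = 0.
Proof. by rewrite /Psi_coef big1 // => j _; rewrite /spsi ltnn mulr0. Qed.

Lemma Psi_coef1 s m : (0 < m)%N -> Psi_coef s 1 m = 0.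
Proof.
case: m => // m _; rewrite /Psi_coef big1 // => j _.
by rewrite /spsi /psi /= if_same mulr0.
Qed.

Lemma Psi_coef_pascal s k m : (2 <= k)%N -> (2 <= m)%N ->
  Psi_coef s k.+1 m + Psi_coef s k m.+1 = Psi_coef s k m.
Proof.
move=> k2 m2; rewrite !(@Psi_coef_widen (maxn k m).+1); try lia.
rewrite -big_split; apply: eq_bigr => j _ /=.
by rewrite -mulrDr spsi_pascal.
Qed.

(** The upper bound is where the binomial coefficient stops: the condition
    [l - k <= m - l - 1] amounts to [2 * l <= k + m - 1].  Since [k < m], it
    forces [l < m], so no subtraction is truncated. *)
Lemma Psi_coefE s k m : (2 <= k)%N -> (k < m)%N ->
  Psi_coef s k m = \sum_(k <= l < ((k + m - 1) %/ 2).+1)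
     (-1) ^+ (l - k) * 'C(m - l - 1, l - k)%:R * x l s.
Proof.
move=> k2 km; rewrite /Psi_coef.
have -> : maxn k m = m by lia.
rewrite (big_cat_nat k2 (ltnW km)) /= big_nat_cond big1 => [|l]; last first.
  by rewrite andbT => /andP[_ lk]; rewrite /spsi km psiE // leqNgt lk mulr0.
rewrite add0r.
rewrite (@big_cat_nat _ _ _ ((k + m - 1) %/ 2).+1) /=; try lia.
rewrite addrC big_nat_cond big1 => [|l]; last first.
  rewrite andbT => l_range; rewrite /spsi km psiE // ifT; last by lia.
  by rewrite bin_small ?mulr0 //; lia.
rewrite add0r; apply: eq_big_nat => l l_range.
by rewrite /spsi km psiE // ifT 1?mulrC //; lia.
Qed.

(** * The square of the series *)

(** The structure constant of the iterated map
    [Psi_u (Psi_t (e_a, e_b), e_c)]. *)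
Definition comp_coef (t u a b c : nat) : K :=
  Psi_coef t a b * Psi_coef u (a + b + t) c.

(** Half the structure constant of the degree [r] part of [[Psi, Psi]]; see
    [NR_series_coefE]. *)
Definition square_coef (r a b c : nat) : K :=
  \sum_(0 <= t < r.+1)
    (comp_coef t (r - t) a b c + comp_coef t (r - t) b c a
     + comp_coef t (r - t) c a b).

Lemma square_coef_cyc r a b c : square_coef r a b c = square_coef r b c a.
Proof. by apply: eq_bigr => t _; rewrite -addrA addrC. Qed.

Lemma comp_coefC t u a b c : comp_coef t u b a c = - comp_coef t u a b c.
Proof. by rewrite /comp_coef Psi_coefC mulNr [(b + a)%N]addnC. Qed.

Lemma square_coefC r a b c : square_coef r b a c = - square_coef r a b c.
Proof.
rewrite -sumrN; apply: eq_bigr => t _.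
rewrite (comp_coefC _ _ a b) (comp_coefC _ _ c a) (comp_coefC _ _ b c).
by ring.
Qed.

Lemma square_coef_diag r a c : square_coef r a a c = 0.
Proof.
apply: big1 => t _; rewrite {1}/comp_coef Psi_coef_diag mul0r add0r.
by rewrite comp_coefC addNr.
Qed.

Lemma square_coef1 r b c : (0 < b)%N -> (0 < c)%N -> square_coef r 1 b c = 0.
Proof.
move=> b0 c0; apply: big1 => t _; rewrite /comp_coef.
rewrite Psi_coef1 // [Psi_coef t c 1]Psi_coefC Psi_coef1 //.
rewrite [Psi_coef _ _ 1]Psi_coefC Psi_coef1; last lia.
by rewrite oppr0 mulr0 !mul0r !addr0.
Qed.

(** Raising [a] or [b] raises the first argument of the outer factor by one in
    both cases, so the inner Pascal rule merges these two terms, and the outer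
    Pascal rule absorbs the third. *)
Lemma comp_coef_pascal t u a b c :
  (2 <= a)%N -> (2 <= b)%N -> (2 <= c)%N ->
  comp_coef t u a.+1 b c + comp_coef t u a b.+1 c + comp_coef t u a b c.+1
  = comp_coef t u a b c.
Proof.
move=> a2 b2 c2; rewrite /comp_coef !addSn addnS addSn.
rewrite -mulrDl Psi_coef_pascal // -mulrDr Psi_coef_pascal //; lia.
Qed.

Lemma square_coef_pascal r a b c :
  (2 <= a)%N -> (2 <= b)%N -> (2 <= c)%N ->
  square_coef r a.+1 b c + square_coef r a b.+1 c + square_coef r a b c.+1
  = square_coef r a b c.
Proof.
move=> a2 b2 c2; rewrite /square_coef -!big_split; apply: eq_bigr => t _ /=.
rewrite -(comp_coef_pascal _ _ a2 b2 c2) -(comp_coef_pascal _ _ b2 c2 a2).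
rewrite -(comp_coef_pascal _ _ c2 a2 b2); ring.
Qed.

(** Induction on the gap [c - b].  The Pascal rule at [(a, b, c)] yields the
    value at [(a, b, c+1)], since the other three triples have a smaller gap or
    a repeated entry. *)
Lemma square_coef_eq0_sorted r :
  (forall j q, (2 <= j)%N -> (j < q)%N -> square_coef r j q q.+1 = 0) ->
  forall a b c, (2 <= a)%N -> (a < b)%N -> (b < c)%N -> square_coef r a b c = 0.
Proof.
move=> base a b c; have [n] := ubnP (c - b)%N.
elim: n a b c => // n IH a b c cbn a2 ab bc.
have [c_eq|c_ne] := eqVneq c b.+1; first by rewrite c_eq base.
case: c cbn bc c_ne => // c cbn bc c_ne.
have [b2 c2] : (2 <= b)%N /\ (2 <= c)%N by lia.
have := square_coef_pascal r a2 b2 c2.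
have -> : square_coef r a b c = 0 by apply: IH; lia.
have -> : square_coef r a.+1 b c = 0.
  have [<-|ne_ab] := eqVneq a.+1 b; first exact: square_coef_diag.
  by apply: IH; lia.
have -> : square_coef r a b.+1 c = 0.
  have [<-|ne_bc] := eqVneq b.+1 c.
    by rewrite square_coef_cyc square_coef_diag.
  by apply: IH; lia.
by rewrite !add0r.
Qed.

(** Skew symmetry reduces to sorted triples, and the entry 1, where the Pascal
    rule fails, is covered by [square_coef1]. *)
Lemma square_coef_eq0 r :
  (forall j q, (2 <= j)%N -> (j < q)%N -> square_coef r j q q.+1 = 0) ->
  forall a b c, (0 < a)%N -> (0 < b)%N -> (0 < c)%N -> square_coef r a b c = 0.
Proof.
move=> base; have sorted0 := square_coef_eq0_sorted base.
suff min0 a b c : (0 < a)%N -> (a <= b)%N -> (a <= c)%N ->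
    square_coef r a b c = 0.
  move=> a b c a0 b0 c0.
  have [ab|ba] := leqP a b; have [ac|ca] := leqP a c.
  - exact: min0.
  - by rewrite -square_coef_cyc min0 //; lia.
  - by rewrite square_coef_cyc min0 //; lia.
  have [bc|cb] := leqP b c; first by rewrite square_coef_cyc min0 //; lia.
  by rewrite -square_coef_cyc min0 //; lia.
move=> a0 ab ac.
have [a1|a_ne1] := eqVneq a 1%N; first by rewrite a1 square_coef1 //; lia.
have [->|a_neb] := eqVneq a b; first exact: square_coef_diag.
have [->|a_nec] := eqVneq a c.
  by rewrite -square_coef_cyc square_coef_diag.
case: (ltngtP b c) => [bc|cb|->].
- by apply: sorted0; lia.
- rewrite square_coef_cyc square_coefC -square_coef_cyc.
  by rewrite sorted0 ?oppr0 //; lia.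
- by rewrite square_coef_cyc square_coef_diag.
Qed.

(** * The polynomials F as values of the square *)

Lemma Psi_coef_succ s q : (2 <= q)%N -> Psi_coef s q q.+1 = x q s.
Proof.
move=> q2; rewrite Psi_coefE //.
have -> : ((q + q.+1 - 1) %/ 2 = q)%N by lia.
by rewrite big_nat1 subnn bin0 !mul1r.
Qed.

(** The three sums of [F] are the cyclic terms starting from [(j, q)],
    [(q+1, j)] and [(q, q+1)].  Skew symmetry puts the arguments of each
    [Psi_coef] in increasing order before [Psi_coefE] applies; the resulting
    signs are those of [F], whose [m]-ranges all end at
    [(2 * q + j + t) %/ 2]. *)
Lemma F_square_coef j q r : (2 <= j)%N -> (j < q)%N ->
  F x j q r = square_coef r j q q.+1.
Proof.
move=> j2 jq; rewrite /F -!big_split; apply: eq_bigr => t _ /=.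
have q2 : (2 <= q)%N by lia.
rewrite [RHS]addrAC /comp_coef; congr (_ + _ + _).
- rewrite Psi_coefE // [Psi_coef (r - t) _ _]Psi_coefC Psi_coefE; try lia.
  have -> : (q.+1 + (j + q + t) - 1 = q * 2 + (j + t))%N by lia.
  rewrite divnMDl // addn1 -sumrN big_distrlr /=.
  apply: eq_bigr => l _; apply: eq_big_nat => m m_range.
  (* The sum starts at [q + 1], and the minus sign from skew symmetry turns
     the exponent [m - (q + 1)] into [m - q]. *)
  have -> : (m - q = (m - q.+1).+1)%N by lia.
  by rewrite [(_.+1 - 1)%N]subn1 /= exprD exprS; ring.
- rewrite [Psi_coef t _ _]Psi_coefC Psi_coefE; try lia.
  rewrite [Psi_coef (r - t) _ _]Psi_coefC Psi_coefE; try lia.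
  have -> : (q + (q.+1 + j + t) - 1 = q * 2 + (j + t))%N by lia.
  have -> : (j + q.+1 - 1 = j + q)%N by lia.
  rewrite divnMDl // mulrNN big_distrlr /=.
  apply: eq_bigr => l _; apply: eq_big_nat => m m_range.
  have -> : (q.+1 - l - 1 = q - l)%N by lia.
  have -> : (q.+1 + j + t - m - 1 = j + q + t - m)%N by lia.
  by rewrite exprD; ring.
- rewrite Psi_coef_succ // Psi_coefC Psi_coefE; try lia.
  have -> : (j + (q + q.+1 + t) - 1 = q * 2 + (j + t))%N by lia.
  rewrite divnMDl // -sumrN mulr_sumr; apply: eq_big_nat => m m_range.
  have -> : (q + q.+1 + t - m - 1 = 2 * q + t - m)%N by lia.
  by rewrite addn1 exprS; ring.
Qed.

(** The first three terms of the bracket of [Psi_s] and [Psi_(r-s)] become its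
    last three under [s <-> r - s], which is the origin of the factor 2. *)
Lemma NR_series_coefE r a b c : (0 < a)%N -> (0 < b)%N -> (0 < c)%N ->
  NR_series (Psi_comp x) (Psi_comp x) r (e a) (e b) (e c)
  = (square_coef r a b c *+ 2) *: e (a + b + c + r) :> m0 K.
Proof.
move=> a0 b0 c0.
have PP t u k l m : (0 < k)%N -> (0 < l)%N -> (0 < m)%N ->
    Psi_comp x u (Psi_comp x t (e k) (e l)) (e m)
    = comp_coef t u k l m *: e (k + l + m + (t + u)) :> m0 K.
  move=> k0 l0 mpos; rewrite Psi_comp_coefE // /Psi_comp skew_extZl.
  rewrite -/(Psi_comp x u _ _) Psi_comp_coefE //; last lia.
  by rewrite scalerA; congr (_ *: e _); lia.
pose half t : m0 K := (comp_coef t (r - t) a b c + comp_coef t (r - t) b c a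
     + comp_coef t (r - t) c a b) *: e (a + b + c + r).
have halfE : square_coef r a b c *: e (a + b + c + r)
    = \sum_(0 <= t < r.+1) half t by rewrite scaler_suml.
rewrite mulr2n scalerDl halfE {1}big_nat_rev -big_split.
apply: eq_big_nat => t /andP[_ tr] /=.
have -> : (0 + r.+1 - t.+1 = r - t)%N by lia.
rewrite /half /NR !PP // !scalerDl !addrA.
have -> : (r - (r - t) = t)%N by lia.
have -> : (r - t + t = r)%N by lia.
have -> : (t + (r - t) = r)%N by lia.
have -> : (b + c + a = a + b + c)%N by lia.
by have -> : (c + a + b = a + b + c)%N by lia.
Qed.

End Coefficients.

Theorem theorem3p7 (K : fieldType) (hK : [pchar K] =i pred0)
    (x : nat -> nat -> K) :
  deformation_equation (Psi_comp x) <->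
  (forall j q r : nat, (2 <= j)%N -> (j < q)%N -> F x j q r = 0).
Proof.
split=> [defo j q r j2 jq | F0 r].
  have [j0 q0] : (0 < j)%N /\ (0 < q)%N by lia.
  rewrite F_square_coef //; apply/eqP.
  have /eqP := defo r (e j) (e q) (e q.+1).
  rewrite NR_series_coefE // scaler_eq0 (negbTE (e_neq0 _ _)) ?orbF; last lia.
  by rewrite -mulr_natr mulf_eq0 ((pcharf0P K).1 hK) orbF.
apply: NR_series_eq0_basis => [s|a b c a0 b0 c0]; first exact: skew_ext_bilin.
rewrite NR_series_coefE // square_coef_eq0 ?mul0rn ?scale0r // => j q j2 jq.
by rewrite -F_square_coef // F0.
Qed.
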